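(* Let $f,g:2^V\to\mathbb{R}$ be submodular functions on a finite ground set $V$ with $g(\emptyset)=0$, and let $v=f-g$ be normalized, $v(\emptyset)=0$, and attain its minimum at a negative value. Consider the $\epsilon$-approximate versions of the three procedures SubSup, SupSub, ModMod (described in the context), started from $X^0=\emptyset$. Each of them has a worst case complexity of $$O\!\left(\frac{\log(|M|/|m|)}{\epsilon}\,T\right),$$ where $$M=f'(\emptyset)+\sum_{j\in V}\min\big(v(j|V\setminus j),0\big)-g'(V),\qquad m=v(X^1),$$ with $f'(X)=f(X)-\sum_{j\in X}f(j|V\setminus j)$ and $g'(X)=g(X)-\sum_{j\in X}g(j|V\setminus j)$, and where $O(T)$ is the complexity of every iteration of the procedure (which corresponds to, respectively, the submodular minimization in SubSup, the submodular maximization in SupSub, and the modular minimization in ModMod).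
   Context: A set function $f:2^V\to\mathbb{R}$ is submodular if $f(S)+f(T)\ge f(S\cup T)+f(S\cap T)$ for all $S,T\subseteq V$. Write $w(A|B)=w(A\cup B)-w(B)$ for any set function $w$, and $j$ for $\{j\}$. Modular upper bounds of $f$ at $X$: $$m^f_{X,1}(Y)=f(X)-\sum_{j\in X\setminus Y}f(j|X\setminus j)+\sum_{j\in Y\setminus X}f(j|\emptyset),\quad m^f_{X,2}(Y)=f(X)-\sum_{j\in X\setminus Y}f(j|V\setminus j)+\sum_{j\in Y\setminus X}f(j|X);$$ $m^f_X$ denotes either one. Modular lower bound of $g$: for a permutation $\sigma$ of $V$ let $S^\sigma_i=\{\sigma(1),\dots,\sigma(i)\}$; its chain contains $Y$ if $S^\sigma_{|Y|}=Y$. For such $\sigma$, $h^g_{Y,\sigma}(\sigma(1))=g(S^\sigma_1)$, $h^g_{Y,\sigma}(\sigma(i))=g(S^\sigma_i)-g(S^\sigma_{i-1})$ for $i\ge2$, and $h^g_{Y,\sigma}(X)=\sum_{j\in X}h^g_{Y,\sigma}(j)$. The three procedures for minimizing $v$ start with $X^0=\emptyset$ and, at iteration $t$, compute a next set $X^{t+1}$ as follows (where $\sigma^t$ is a chosen permutation whose chain contains $X^t$), stopping when $X^{t+1}=X^t$: - SubSup: $X^{t+1}\in\operatorname{argmin}_X f(X)-h^g_{X^t,\sigma^t}(X)$ (submodular minimization). - SupSub: $X^{t+1}$ is a (possibly approximate) minimizer of $m^f_{X^t}(X)-g(X)$ (submodular maximization), the step being taken only if $v$ does not increase. - ModMod: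 $X^{t+1}\in\operatorname{argmin}_X m^f_{X^t}(X)-h^g_{X^t,\sigma^t}(X)$ (modular minimization). The $\epsilon$-approximate version of such an iterative procedure is the version that proceeds to step $t+1$ only if $v(X^{t+1})\le v(X^t)(1+\epsilon)$.
   Formalization: The bound proved is O(max(1, log(|M|/|m|)/ε)·T), with a constant depending on an arbitrary upper bound for ε, and m ≠ 0 is assumed; the literal bound is 0 when M = m (V={1}, f({1})=−1, g=0) and tends to 0 as ε grows, although iterations are run. *)

(* Defs.v *)
From HB Require Import structures.
From mathcomp Require Import all_boot all_order all_algebra.
From mathcomp Require Import reals exp.
Set Implicit Arguments.
Unset Strict Implicit.
Unset Printing Implicit Defensive.
Import Order.TTheory GRing.Theory Num.Theory.
Local Open Scope ring_scope.

Section SetFunctions.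
Variables (R : realType) (V : finType).
Implicit Types (f g w : {set V} -> R) (X Y Z : {set V}) (s : seq V).

Definition submodular w :=
  forall X Y, w (X :|: Y) + w (X :&: Y) <= w X + w Y.

(* w(A | B) *)
Definition gain w (A B : {set V}) : R := w (A :|: B) - w B.

Definition modular_ub1 f X Y : R :=
  f X - \sum_(j in X :\: Y) gain f [set j] (X :\ j)
      + \sum_(j in Y :\: X) gain f [set j] finset.set0.

Definition modular_ub2 f X Y : R :=
  f X - \sum_(j in X :\: Y) gain f [set j] (finset.setT :\ j)
      + \sum_(j in Y :\: X) gain f [set j] X.

(* m^f_X is either of the two bounds; [b] says which one. *)
Definition modular_ub (b : bool) f X Y : R :=
  if b then modular_ub1 f X Y else modular_ub2 f X Y.

(* A permutation sigma of V is the list [sigma(1); ...; sigma(#|V|)]. *)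
Definition is_ordering s := perm_eq s (enum V).

Definition prefix_set s (i : nat) : {set V} := [set x in take i s].

Definition chain_contains s Y := prefix_set s #|Y| = Y.

(* The 0-based index i of j in s is such that j = sigma(i + 1). *)
Definition modular_lb_elt g s (j : V) : R :=
  if index j s is i.+1 then g (prefix_set s i.+2) - g (prefix_set s i.+1)
  else g (prefix_set s 1).

Definition modular_lb g s X : R := \sum_(j in X) modular_lb_elt g s j.

Definition is_argmin w X := forall Z, w X <= w Z.

(* X minimizes w up to the additive error delta. *)
Definition is_approx_argmin (delta : R) w X := forall Z, w X <= w Z + delta.

End SetFunctions.

(* The parameter of SupSub is the accuracy of its submodular maximization;
   0 is exact maximization. As there are finitely many sets, any approximation
   guarantee (a multiplicative one, for instance) yields some accuracy. *)
Inductive procedure (R : Type) := SubSup | SupSub of R | ModMod.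
Arguments SubSup {R}.
Arguments ModMod {R}.

Section Procedures.
Variables (R : realType) (V : finType).
Implicit Types (f g w : {set V} -> R) (X Y Z : {set V}).

(* The relation between X^t and the possible X^(t+1). A rejected SupSub
   candidate leaves X unchanged, which is the stopping condition. *)
Definition next_set (p : procedure R) f g X X' : Prop :=
  match p with
  | SubSup => exists s : seq V, [/\ is_ordering s, chain_contains s X
      & is_argmin (f \- modular_lb g s) X']
  | SupSub delta => exists b Y,
      is_approx_argmin delta (modular_ub b f X \- g) Y /\
      X' = if (f \- g) Y <= (f \- g) X then Y else X
  | ModMod => exists b (s : seq V), [/\ is_ordering s, chain_contains s X
      & is_argmin (modular_ub b f X \- modular_lb g s) X']
  end.

(* X 0, ..., X n are the sets produced by n iterations of the eps-approximate
   procedure. The execution need not be complete, so a bound on n for all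
   executions also entails termination. *)
Definition approx_execution (p : procedure R) f g (eps : R)
    (X : nat -> {set V}) (n : nat) : Prop :=
  [/\ X 0%N = finset.set0,
      forall t, (t < n)%N -> next_set p f g (X t) (X t.+1)
    & forall t, (t.+1 < n)%N ->
        X t.+1 <> X t /\
        (f \- g) (X t.+1) <= (f \- g) (X t) * (1 + eps)].

(* f' and g' *)
Definition reduced w X : R :=
  w X - \sum_(j in X) gain w [set j] (finset.setT :\ j).

Definition global_lb f g : R :=
  reduced f finset.set0
  + \sum_(j : V) Num.min (gain (f \- g) [set j] (finset.setT :\ j)) 0
  - reduced g finset.setT.

End Procedures.

(* Main.v *)
Require Import Defs.
From mathcomp Require Import all_boot all_order all_algebra.
From mathcomp Require Import reals exp.
From mathcomp Require Import ring lra.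
Set Implicit Arguments.
Unset Strict Implicit.
Unset Printing Implicit Defensive.
Import Order.TTheory GRing.Theory Num.Theory.
Local Open Scope ring_scope.

(* The bounds f <= m^f and h^g <= g give v(X^1) <= 0, hence m < 0. Every
   accepted step after the first one multiplies v < 0 by a factor at least
   1 + eps, while v >= M because f' and g' are nondecreasing. Hence
   |m| (1 + eps)^(n - 2) <= |M|, and ln (1 + eps) >= eps / (1 + eps). *)

Section Submodular.
Variables (R : realType) (V : finType).
Implicit Types (f g w u : {set V} -> R) (X Y : {set V}).

(** Diminishing returns: this is submodularity applied to [j |: X] and [Y], whose union is [j |: Y]
    and whose intersection is [X] because [j] lies outside [Y]. *)
Lemma gain_antitone w X Y j : submodular w -> X \subset Y -> j \notin Y ->
  gain w [set j] Y <= gain w [set j] X.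
Proof.
move=> sub_w sXY jNY; rewrite /gain lerBlDr addrAC lerBrDr.
have := sub_w (j |: X) Y.
rewrite -setUA (setUidPr sXY) setIUl (setIidPl sXY).
have -> : [set j] :&: Y = finset.set0.
  by apply/setP=> x; rewrite !inE; case: eqP => // ->; rewrite (negbTE jNY).
by rewrite set0U.
Qed.

Lemma homo_setU1 u :
    (forall X j, j \notin X -> u X <= u (j |: X)) ->
  forall X Y, X \subset Y -> u X <= u Y.
Proof.
move=> u_step X Y; move: {2}#|Y :\: X| (leqnn #|Y :\: X|) => k.
elim: k X => [|k IHk] X leYXk sXY.
  have : Y \subset X by rewrite -setD_eq0 -cards_eq0 -leqn0.
  by move=> sYX; have -> : X = Y by apply/eqP; rewrite eqEsubset sXY.
have [/eqP|[j jYX]] := set_0Vmem (Y :\: X).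
  rewrite setD_eq0 => sYX.
  by have -> : X = Y by apply/eqP; rewrite eqEsubset sXY.
have /[!inE] /andP[jNX jY] := jYX.
apply: le_trans (u_step X j jNX) (IHk _ _ _).
  by rewrite setUC -setDDl -ltnS; move: leYXk; rewrite (cardsD1 j) jYX.
by rewrite subUset sub1set jY.
Qed.

(** Adding [j] to [X] changes [reduced w] by the gain of [j] over [X] minus its gain over
    [setT :\ j], which is nonnegative by diminishing returns. *)
Lemma reduced_homo w X Y :
  submodular w -> X \subset Y -> reduced w X <= reduced w Y.
Proof.
move=> sub_w; apply: homo_setU1 => {}X j jNX.
rewrite /reduced big_setU1 //= opprD addrA lerD2r lerBrDr addrC -lerBrDr.
by apply: gain_antitone => //; rewrite ?subsetD1 ?subsetT ?jNX // !inE eqxx.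
Qed.

Lemma le_sum_gain0 w Y : submodular w ->
  w Y <= w finset.set0 + \sum_(j in Y) gain w [set j] finset.set0.
Proof.
move=> sub_w.
(* The slack of the bound, up to a constant; adding [j] raises it by the gain of [j] over the empty
   set minus that over [X]. *)
pose u X := \sum_(j in X) gain w [set j] finset.set0 - w X.
suff : u finset.set0 <= u Y by rewrite /u big_set0; lra.
apply: homo_setU1 (sub0set Y) => X j jNX.
have := gain_antitone sub_w (sub0set X) jNX.
by rewrite /u big_setU1 //= {1}/gain; lra.
Qed.

(** At the empty set both modular upper bounds become the same sum of singleton gains. This is the
    base point of the first iteration. *)
Lemma modular_ub_set0 b f Y : submodular f ->
  f Y <= modular_ub b f finset.set0 Y.
Proof.
move=> sub_f; apply: le_trans (le_sum_gain0 Y sub_f) _.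
by case: b; rewrite /modular_ub /modular_ub1 /modular_ub2 set0D setD0 big_set0 subr0.
Qed.

Lemma modular_ub_set0_set0 b f :
  modular_ub b f finset.set0 finset.set0 = f finset.set0.
Proof.
by case: b; rewrite /modular_ub /modular_ub1 /modular_ub2 setD0 !big_set0 subr0 addr0.
Qed.

Lemma prefix_setS (s : seq V) x0 i : (i < size s)%N ->
  prefix_set s i.+1 = nth x0 s i |: prefix_set s i.
Proof.
by move=> lt_i; apply/setP=> x; rewrite !inE (take_nth x0) // mem_rcons inE.
Qed.

(** Normalization of [g] merges the special first case of [modular_lb_elt] into the general
    difference. *)
Lemma modular_lb_elt_nth g (s : seq V) x0 i :
    g finset.set0 = 0 -> uniq s -> (i < size s)%N ->
  modular_lb_elt g s (nth x0 s i) = g (prefix_set s i.+1) - g (prefix_set s i).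
Proof.
move=> g0 uniq_s lt_i; rewrite /modular_lb_elt index_uniq //.
case: i lt_i => // _; have -> : prefix_set s 0 = finset.set0.
  by apply/setP=> x; rewrite !inE take0.
by rewrite g0 subr0.
Qed.

(** Induction on the prefix to which [X] is truncated: a new element of [X] adds to the modular
    bound its gain over the whole prefix, at most its gain over the part of [X] in that prefix. *)
Lemma modular_lb_le g (s : seq V) X :
    submodular g -> g finset.set0 = 0 -> is_ordering s ->
  modular_lb g s X <= g X.
Proof.
move=> sub_g g0 ord_s.
have uniq_s : uniq s by rewrite (perm_uniq ord_s) enum_uniq.
have mem_s x : x \in s by rewrite (perm_mem ord_s) mem_enum.
suff lb_prefix i : (i <= size s)%N ->
    modular_lb g s (X :&: prefix_set s i) <= g (X :&: prefix_set s i).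
  have := lb_prefix _ (leqnn (size s)); suff -> : prefix_set s (size s) = setT.
    by rewrite finset.setIT.
  by apply/setP=> x; rewrite !inE take_size mem_s.
elim: i => [_|i IHi lt_i].
  have -> : prefix_set s 0 = finset.set0 by apply/setP=> x; rewrite !inE take0.
  by rewrite finset.setI0 /modular_lb big_set0 g0.
have {IHi} le_i := IHi (ltnW lt_i).
have x0 : V by case: (s) lt_i.
rewrite (prefix_setS x0 lt_i) setIUr; set x := nth x0 s i.
have xNi : x \notin prefix_set s i.
  by rewrite inE in_take ?mem_s // index_uniq ?ltnn.
have [xX|xNX] := boolP (x \in X); last first.
  suff -> : X :&: [set x] = finset.set0 by rewrite set0U.
  by apply/setP=> y; rewrite !inE andbC; case: eqP => // ->; rewrite (negbTE xNX).
rewrite (setIidPr _) ?sub1set // /modular_lb big_setU1 /=; last first.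
  by rewrite inE (negbTE xNi) andbF.
rewrite modular_lb_elt_nth // (prefix_setS x0 lt_i) -/x.
have := gain_antitone sub_g (subsetIr X (prefix_set s i)) xNi.
by move: le_i; rewrite /gain /modular_lb; lra.
Qed.

(** Write [v(X)] as [f'(X)] plus the sum over [X] of [v(j | V \ j)], minus [g'(X)], and bound the
    three terms separately: [f'] at the empty set, [g'] at [setT], and the sum by its negative terms
    over all of [V]. *)
Lemma global_lb_le f g X :
  submodular f -> submodular g -> global_lb f g <= (f \- g) X.
Proof.
move=> sub_f sub_g.
have le_f := reduced_homo sub_f (sub0set X).
have le_g := reduced_homo sub_g (subsetT X).
have le_min : \sum_(j : V) Num.min (gain (f \- g) [set j] (setT :\ j)) 0 <=
    \sum_(j in X) gain (f \- g) [set j] (setT :\ j).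
  rewrite (bigID [in X]) /= -[leRHS]addr0 lerD //.
    by apply: ler_sum => j _; rewrite ge_min lexx.
  by rewrite sumr_le0 // => j _; rewrite ge_min lexx orbT.
have sumB : \sum_(j in X) gain (f \- g) [set j] (setT :\ j) =
    \sum_(j in X) gain f [set j] (setT :\ j) -
    \sum_(j in X) gain g [set j] (setT :\ j).
  by rewrite -sumrB; apply: eq_bigr => j _; rewrite /gain /=; ring.
move: le_f le_g le_min; rewrite sumB /global_lb /=.
by rewrite {2}/reduced {1}(_ : reduced g X = g X - \sum_(j in X) gain g [set j] (setT :\ j)) //; lra.
Qed.

(** For [SubSup] and [ModMod] the minimized surrogate dominates [v] and vanishes at the competitor
    [set0]. *)
Lemma next_set_set0_le0 (p : procedure R) f g X :
    submodular f -> submodular g -> g finset.set0 = 0 ->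
    (f \- g) finset.set0 = 0 -> next_set p f g finset.set0 X ->
  (f \- g) X <= 0.
Proof.
move=> sub_f sub_g g0 v0.
have f0 : f finset.set0 = 0 by move: v0; rewrite /= g0 subr0.
have lb0 s : modular_lb g s finset.set0 = 0 by rewrite /modular_lb big_set0.
case: p => [|delta|] /=.
- move=> [s [ord_s _ /(_ finset.set0)]].
  by have := modular_lb_le X sub_g g0 ord_s; rewrite /= lb0 f0; lra.
(* For [SupSub] the acceptance rule suffices, whatever the accuracy: a rejected candidate leaves
   [set0], of value 0. *)
- move=> [b [Y [_ ->]]]; rewrite f0 g0 subrr.
  by case: ifP => //; rewrite f0 g0 subrr.
- move=> [b [s [ord_s _ /(_ finset.set0)]]].
  have := modular_lb_le X sub_g g0 ord_s; have := modular_ub_set0 b X sub_f.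
  by rewrite /= lb0 modular_ub_set0_set0 f0; lra.
Qed.

End Submodular.

(** The powers start from [X 1], since a multiplicative test says nothing about magnitude at
    [v(X 0) = 0]. The bound [k.+1 < n] reflects that the last set produced need not have passed the
    test. *)
Lemma approx_execution_le (R : realType) (V : finType) (p : procedure R)
    (f g : {set V} -> R) eps X n k :
    0 < eps -> approx_execution p f g eps X n -> (k.+1 < n)%N ->
  (f \- g) (X k.+1) <= (f \- g) (X 1%N) * (1 + eps) ^+ k.
Proof.
move=> eps0 [_ _ decr]; elim: k => [|k IHk] lt_k; first by rewrite expr0 mulr1.
have [_ /le_trans] := decr _ lt_k; apply.
rewrite exprSr mulrA ler_wpM2r //; first by rewrite addr_ge0 // ltW.
exact: IHk (ltnW lt_k).
Qed.

(** Apply [ln (1 + y) <= y] at [y = - x / (1 + x)], where [1 + y] is the inverse of [1 + x]. *)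
Lemma ln1D_ge (R : realType) (x : R) : 0 <= x -> x / (1 + x) <= ln (1 + x).
Proof.
move=> x0; have x1 : 0 < 1 + x by rewrite ltr_pwDl.
have := @le_ln1Dx R (- (x / (1 + x))).
have -> : 1 + - (x / (1 + x)) = (1 + x)^-1 by field; rewrite gt_eqF.
rewrite lnV ?posrE // lerN2; apply.
by rewrite ltrN2 ltr_pdivrMr // mul1r ltrDr.
Qed.

(** In [3 + eps_max], the part [1 + eps_max] bounds the factor [1 + eps] lost in the logarithm
    estimate, and 2 pays for the first and last iterations. The maximum with 1 absorbs those two
    when the logarithm is small. *)
Lemma approx_execution_length (R : realType) (V : finType) (p : procedure R)
    (f g : {set V} -> R) (eps eps_max : R) X n :
    submodular f -> submodular g -> g finset.set0 = 0 ->
    (f \- g) finset.set0 = 0 -> 0 < eps <= eps_max ->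
    approx_execution p f g eps X n -> (f \- g) (X 1%N) != 0 ->
  n%:R <= (3 + eps_max) *
    Num.max 1 (ln (`|global_lb f g| / `|(f \- g) (X 1%N)|) / eps).
Proof.
move=> sub_f sub_g g0 v0 /andP[eps0 le_eps] exec m0.
set L := ln _; set B := Num.max _ _.
have B1 : 1 <= B by rewrite le_max lexx.
have LB : L / eps <= B by rewrite le_max lexx orbT.
have eps_max0 : 0 < eps_max := lt_le_trans eps0 le_eps.
have [le_n1|lt_1n] := leqP n 1.
  by have : n%:R <= 1%:R :> R by [rewrite ler_nat]; nra.
case: n lt_1n exec => [|[|k]] // _ exec.
have m_lt0 : (f \- g) (X 1%N) < 0.
  have [X0 step _] := exec; rewrite lt_neqAle m0.
  by apply: next_set_set0_le0 (sub_f) sub_g g0 v0 _; rewrite -X0; apply: step.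
have eps1 : 0 < 1 + eps by rewrite addr_gt0.
have growth : (1 + eps) ^+ k <= `|global_lb f g| / `|(f \- g) (X 1%N)|.
  have le_pow := approx_execution_le eps0 exec (ltnSn k.+1).
  have le_M := le_trans (global_lb_le (X k.+1) sub_f sub_g) le_pow.
  (* Both [M] and [m] are negative, so passing to absolute values reverses [le_M]. *)
  have M_lt0 : global_lb f g < 0.
    by apply: le_lt_trans le_M _; rewrite nmulr_rlt0 // exprn_gt0.
  rewrite ler_pdivlMr ?normr_gt0 // !ltr0_norm // mulrN lerN2 mulrC.
  exact: le_M.
have le_L : k%:R * (eps / (1 + eps)) <= L.
  apply: le_trans (_ : k%:R * ln (1 + eps) <= _).
    by rewrite ler_wpM2l ?ln1D_ge // ltW.
  rewrite mulr_natl -lnXn // ler_ln ?posrE ?exprn_gt0 //.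
  by apply: lt_le_trans growth; rewrite exprn_gt0.
have le_k : k%:R <= (1 + eps_max) * B.
  apply: le_trans (_ : (1 + eps) * (L / eps) <= _).
    by move: le_L; rewrite mulrA ler_pdivrMr // mulrA ler_pdivlMr // mulrC (mulrC L).
  apply: le_trans (_ : (1 + eps) * B <= _).
    by rewrite ler_pM2l.
  by rewrite ler_wpM2r ?lerD2l // (le_trans _ B1).
by rewrite -addn2 natrD; lra.
Qed.

Theorem theorem5p4 (R : realType) (eps_max A : R) :
  exists C : R, forall (p : procedure R) (V : finType) (f g : {set V} -> R)
    (eps T : R) (X : nat -> {set V}) (n : nat) (cost : nat -> R),
  submodular f -> submodular g ->
  g finset.set0 = 0 -> (f \- g) finset.set0 = 0 ->
  (exists Xmin, is_argmin (f \- g) Xmin /\ (f \- g) Xmin < 0) ->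
  0 < eps <= eps_max ->
  approx_execution p f g eps X n ->
  0 <= T -> (forall t, (t < n)%N -> 0 <= cost t <= A * T) ->
  let M := global_lb f g in
  let m := (f \- g) (X 1%N) in
  m <> 0 ->
  \sum_(t < n) cost t <= C * Num.max 1 (ln (`|M| / `|m|) / eps) * T.
Proof.
(* Cost constant of one iteration times the constant of the length bound; [A] has no prescribed
   sign, hence its absolute value. *)
exists (`|A| * (3 + `|eps_max|)) => p V f g eps T X n cost sub_f sub_g g0 v0 _.
move=> /andP[eps0 le_eps] exec T0 cost_le M m /eqP m0.
have eps_bnd : 0 < eps <= `|eps_max|.
  by rewrite eps0 (le_trans le_eps) // ler_norm.
have len := approx_execution_length sub_f sub_g g0 v0 eps_bnd exec m0.
apply: le_trans (_ : n%:R * (`|A| * T) <= _); last first.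
  have := ler_wpM2r (mulr_ge0 (normr_ge0 A) T0) len; move=> /le_trans; apply.
  by rewrite mulrCA !mulrA.
rewrite mulr_natl -[X in _ *+ X](card_ord n) -sumr_const.
apply: ler_sum => t _; have /andP[_ /le_trans] := cost_le t (ltn_ord t).
by apply; rewrite ler_wpM2r // ler_norm.
Qed.
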